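(* Let $\ell, r \ge 0$ and $n$ be integers with $n \ge (\ell+1)\,r+\ell$. Then $$\nu_{n;\ell,\ell+r}=\binom{n}{\ell}.$$
   Context: Let $[n]=\{1,2,\dots,n\}$. For integers $0\le \ell\le u\le n$, let $\mathcal P_{n;\ell,u}=\{X\subseteq [n]: \ell\le |X|\le u\}$, ordered by inclusion. A maximal interval in $\mathcal P_{n;\ell,u}$ is a set of the form $[A,B]=\{X\subseteq[n]: A\subseteq X\subseteq B\}$ with $A\subseteq B\subseteq [n]$, $|A|=\ell$ and $|B|=u$. The number $\nu_{n;\ell,u}$ denotes the maximum number of pairwise disjoint maximal intervals in $\mathcal P_{n;\ell,u}$ (disjoint as families of subsets of $[n]$). *)

(* Defs.v *)
From mathcomp Require Import all_boot.

Set Implicit Arguments.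
Unset Strict Implicit.
Unset Printing Implicit Defensive.

(* The ground set [n] is represented by 'I_n = {0, ..., n-1}. *)

Definition levels (n l u : nat) : {set {set 'I_n}} :=
  [set X : {set 'I_n} | l <= #|X| <= u].

Definition interval (n : nat) (A B : {set 'I_n}) : {set {set 'I_n}} :=
  [set X : {set 'I_n} | (A \subset X) && (X \subset B)].

Definition maximal_interval (n l u : nat) (I : {set {set 'I_n}}) : bool :=
  [exists A : {set 'I_n}, exists B : {set 'I_n},
    [&& A \subset B, #|A| == l, #|B| == u & I == interval A B]].

Lemma maximal_interval_sub (n l u : nat) (I : {set {set 'I_n}}) :
  maximal_interval l u I -> I \subset levels n l u.
Proof.
case/existsP=> A /existsP[B /and4P[_ /eqP <- /eqP <- /eqP ->]].
apply/subsetP=> X; rewrite !inE => /andP[sAX sXB].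
by rewrite !subset_leq_card.
Qed.

Definition disjoint_maximal_intervals (n l u : nat)
    (F : {set {set {set 'I_n}}}) : bool :=
  [forall I in F, maximal_interval l u I] && trivIset F.

Definition nu (n l u : nat) : nat :=
  \max_(F : {set {set {set 'I_n}}} | disjoint_maximal_intervals l u F) #|F|.

(* Main.v *)
Require Import Defs.
From mathcomp Require Import all_boot.
From mathcomp Require Import zify.

Set Implicit Arguments.
Unset Strict Implicit.
Unset Printing Implicit Defensive.

(** Every maximal interval contains exactly one set of size l, its bottom, and
disjoint intervals have distinct bottoms; this gives the bound 'C(n, l)
([nu_le_bin]).  To attain it, each l-set A needs a reserve R(A) of r elements
outside A such that the intervals [A, A :|: R(A)] are pairwise disjoint.  Two
such intervals share a set exactly when each bottom lies below the other top,
so for A <> A' one must exclude that both A' :\: A is included in R(A) and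
A :\: A' in R(A') ([bin_le_nu] turns this into the lower bound).

The reserve comes from a queue.  Suppose first that n = (l + 1) * r + l, so
that n + 1 = (l + 1) * (r + 1), and go round the cycle 0, ..., n - 1: each
element of A brings r jobs, and every other position serves one pending job, or
is idle if there is none.  As l * r jobs meet n - l = l * r + r servers, the
queue has a steady state, returning to its initial load after one turn
([load_periodic]), and exactly r positions are idle.  These form R(A).

Suppose A' :\: A is idle for A, and A :\: A' is idle for A'.  At a position of
A' :\: A the queue of A is empty and stays empty while that of A' grows by r,
and conversely; so the larger of the two loads grows by r at every position of
A :|: A', and elsewhere decreases by at most 1 ([max_load_balance]).  Since it
is the same after one turn, (r + 1) * #|A :|: A'| <= n < (r + 1) * (l + 1).
Hence #|A :|: A'| <= l, and A = A'.

For larger n, the queue of A is run on a window 0, ..., m - 1 on which the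
equality m + 1 = (k + 1) * (r + 1) holds for k the number of elements of A
below m.  Taking the largest such m makes the window canonical: if the
two intervals met, A and A' would agree outside the larger window, which would
then be a window for both sets, and the two windows would coincide
([steady_window_separated]). *)

(** * Counting below a bound *)

Definition count_below (a : pred nat) (m : nat) : nat := count a (iota 0 m).

Lemma count_below0 a : count_below a 0 = 0.
Proof. by []. Qed.

Lemma count_belowS a m : count_below a m.+1 = count_below a m + a m.
Proof. by rewrite /count_below -addn1 iotaD count_cat /= addn0. Qed.

Lemma card_count_below n m (p : pred nat) : m <= n ->
  #|[set x : 'I_n | (x < m) && p x]| = count_below p m.
Proof.
move=> le_mn; rewrite -sum1dep_card /count_below -sum1_count.
rewrite -{2}[m]subn0 -/(index_iota 0 m) big_mkord.
rewrite (big_ord_widen_cond n p (fun=> 1)) //.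
by apply: eq_bigl => x; rewrite andbC.
Qed.

(** A window of one set is recognised as a window of another through its count
alone, and this transports the count when the sets differ only inside it. *)
Lemma count_below_tail (a b : pred nat) m n : m <= n ->
    (forall x, m <= x < n -> a x = b x) ->
  count_below a n = count_below b n -> count_below a m = count_below b m.
Proof.
elim: n => [|n IHn]; first by rewrite leqn0 => /eqP->.
rewrite leq_eqVlt => /predU1P[-> //|]; rewrite ltnS => le_mn eq_ab.
rewrite !count_belowS eq_ab ?le_mn ?ltnSn // => /addIn; apply: IHn => //.
by move=> x /andP[le_mx lt_xn]; rewrite eq_ab // le_mx ltnW.
Qed.

Lemma count_below_sub (a b : pred nat) m :
    (forall x, x < m -> a x -> b x) -> count_below b m <= count_below a m ->
  forall x, x < m -> a x = b x.
Proof.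
elim: m => // m IHm sub_ab; rewrite !count_belowS => le_ba x.
have sub_m y : y < m -> a y -> b y by move=> lt_ym; apply: sub_ab; apply: ltnW.
have le_ab : count_below a m <= count_below b m.
  elim: (m) sub_m => // k IHk sub_k; rewrite !count_belowS.
  have {}IHk := IHk (fun y lt_yk => sub_k y (ltnW lt_yk)).
  by have := sub_k k (ltnSn k); case: (a k) => [-> //|_]; lia.
have sub_am := sub_ab m (ltnSn m).
rewrite ltnS leq_eqVlt => /predU1P[->|]; last by apply: IHm => //; lia.
by case: (a m) sub_am le_ba => [/(_ isT)->|_] //; case: (b m) => //=; lia.
Qed.

(** * The queue *)

(** The number of pending jobs on arrival at position [t], when [s] jobs are
pending at position 0. *)
Fixpoint load (r : nat) (a : pred nat) (s t : nat) : nat :=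
  if t is t'.+1 then
    if a t' then load r a s t' + r else (load r a s t').-1
  else s.

Definition idle (r : nat) (a : pred nat) (s : nat) : pred nat :=
  [pred t | ~~ a t & load r a s t == 0].

Lemma idleE r a s t : idle r a s t = ~~ a t && (load r a s t == 0).
Proof. by []. Qed.

(** Conservation of jobs: each position serves one job, except that an element of
[a] brings [r] jobs instead of serving one, and an idle position has nothing to
serve. *)
Lemma load_balance r a s t :
  load r a s t + t =
  s + r.+1 * count_below a t + count_below (idle r a s) t.
Proof.
elim: t => [|t IHt]; first by rewrite !count_below0 /=; lia.
rewrite !count_belowS idleE /=.
by case: (a t) => /=; last case: eqP => /=; lia.
Qed.

Lemma load_mono r a s s' t : s <= s' -> load r a s t <= load r a s' t.
Proof. by move=> le_ss'; elim: t => //= t IHt; case: (a t); lia. Qed.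

(** The final load is a monotone function of the initial load [s], and it does not
exceed [s] when [s] is large, since no position is then idle.  By monotonicity,
the least [s] with this property is a fixed point. *)
Lemma load_periodic r a m : r.+1 * count_below a m <= m ->
  exists s, load r a s m = s.
Proof.
move=> le_am.
have ex_s : exists s, load r a s m <= s.
  (* Starting from load m, the queue cannot become empty in fewer than m steps. *)
  exists m; have lb t : m <= load r a m t + t.
    by elim: t => [|t IHt] /=; [lia | case: (a t); lia].
  have idle0 t : t <= m -> count_below (idle r a m) t = 0.
    elim: t => // t IHt lt_tm; rewrite count_belowS idleE IHt ?(ltnW lt_tm) //=.
    by have := lb t; case: (a t) => //=; case: eqP => //=; lia.
  by have := load_balance r a m m; rewrite idle0 //; lia.
exists (ex_minn ex_s); case: ex_minnP => s le_s min_s.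
by apply/eqP; rewrite eqn_leq le_s min_s // load_mono.
Qed.

(** * Windows *)

(** On a window of length [m] with [k] elements of [a], the servers exceed the
jobs by exactly [r], and one more element would overload the queue. *)
Definition is_cut (r : nat) (a : pred nat) (m : nat) : bool :=
  m.+1 == r.+1 * (count_below a m).+1.

(** Read downwards from [n], the difference between [m + 1] and
[(r + 1) * (k + 1)] starts nonnegative and drops by at most 1 at each step,
while at [m = 0] it is [- r <= 0]; so it vanishes somewhere. *)
Lemma cut_exists r a n : r.+1 * (count_below a n).+1 <= n.+1 ->
  exists2 m, m <= n & is_cut r a m.
Proof.
elim: n => [|n IHn] le_an.
  by exists 0; rewrite // /is_cut eqn_leq le_an count_below0 muln1.
case: (boolP (is_cut r a n.+1)) => [cut_n|]; first by exists n.+1.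
rewrite /is_cut => /eqP ncut_n; case: IHn => [|m le_mn cut_m].
  by move: le_an ncut_n; rewrite count_belowS; case: (a n); nia.
by exists m => //; apply: leqW.
Qed.

(** The pair [(m, s)] carries all the data of a reserve: the canonical window [m]
and a load [s] that the queue on this window reproduces. *)
Definition steady_window (r n : nat) (a : pred nat) (m s : nat) : Prop :=
  [/\ m <= n, is_cut r a m, forall k, k <= n -> is_cut r a k -> k <= m
    & load r a s m = s].

Lemma steady_window_exists r n a : r.+1 * (count_below a n).+1 <= n.+1 ->
  exists ms, steady_window r n a ms.1 ms.2.
Proof.
move=> le_an.
have ex_m : exists m, (m <= n) && is_cut r a m.
  by have [m le_mn cut_m] := cut_exists le_an; exists m; rewrite le_mn.
have ub_m m : (m <= n) && is_cut r a m -> m <= n by case/andP.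
case: (ex_maxnP ex_m ub_m) => m /andP[le_mn cut_m] max_m.
have [s per_s] : exists s, load r a s m = s.
  by apply: load_periodic; move/eqP: cut_m; lia.
by exists (m, s); split=> // k le_kn cut_k; rewrite max_m ?le_kn.
Qed.

Lemma count_idle r n a m s : steady_window r n a m s ->
  count_below (idle r a s) m = r.
Proof.
by case=> _ /eqP cut_m _ per_s; have := load_balance r a s m; lia.
Qed.

(** Only an inequality is claimed because, at a position outside both sets where
both queues are empty, the larger load stays 0 instead of dropping by 1.  At a
position of exactly one of the sets, idleness of the other queue is what keeps
the larger load from losing anything: the growing queue is then the larger
one. *)
Lemma max_load_balance r (a b : pred nat) s s' m :
    (forall t, t < m -> a t -> ~~ b t -> idle r b s' t) ->
    (forall t, t < m -> b t -> ~~ a t -> idle r a s t) ->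
  maxn s s' + r.+1 * count_below (predU a b) m <=
  maxn (load r a s m) (load r b s' m) + m.
Proof.
elim: m => [|m IHm] idle_b idle_a; first by rewrite count_below0 /=; lia.
have {}IHm : maxn s s' + r.+1 * count_below (predU a b) m <=
    maxn (load r a s m) (load r b s' m) + m.
  by apply: IHm => t lt_tm; [apply: idle_b | apply: idle_a]; apply: ltnW.
have := idle_b m (ltnSn m); have := idle_a m (ltnSn m).
rewrite count_belowS !idleE /=; case: (a m); case: (b m) => /=.
- lia.
- by move=> _ /(_ isT isT) /eqP; lia.
- by move=> /(_ isT isT) /eqP; lia.
- lia.
Qed.

(** Once the two windows are known to coincide, the larger load bounds the union
of the two sets on the window by the size of either, which forces equality. *)
Lemma steady_window_separated r n (a b : pred nat) m m' s s' :
    steady_window r n a m s -> steady_window r n b m' s' ->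
    count_below a n = count_below b n ->
    (forall x, x < n -> a x -> ~~ b x -> (x < m') && idle r b s' x) ->
    (forall x, x < n -> b x -> ~~ a x -> (x < m) && idle r a s x) ->
  forall x, x < n -> a x = b x.
Proof.
wlog le_mm' : a b m m' s s' / m <= m' => [hwlog | ].
  move=> Pa Pb eq_ab sub_a sub_b x lt_xn.
  case: (leqP m m') => [le_mm'|/ltnW le_m'm].
    exact: (hwlog a b m m' s s').
  exact/esym/(hwlog b a m' m s' s).
move=> [le_mn cut_a max_a per_a] [le_m'n cut_b max_b per_b] eq_ab sub_a sub_b.
(* Positions beyond the larger window are in neither reserve. *)
have agree x : m' <= x < n -> a x = b x.
  case/andP=> le_m'x lt_xn; have := sub_a x lt_xn; have := sub_b x lt_xn.
  rewrite !ltnNge le_m'x (leq_trans le_mm' le_m'x) /=.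
  case: (a x) (b x) => [] [] //= xb xa.
    by have := xa isT isT.
  by have := xb isT isT.
have eq_m' := count_below_tail le_m'n agree eq_ab.
have def_m : m' = m.
  by apply/eqP; rewrite eqn_leq le_mm' max_a // /is_cut eq_m'.
subst m'.
have := @max_load_balance r a b s s' m.
rewrite per_a per_b => overload.
have {}overload : r.+1 * count_below (predU a b) m <= m.
  rewrite -(leq_add2l (maxn s s')); apply: overload => t lt_tm at_ bt_.
    by have /andP[] := sub_a t (leq_trans lt_tm le_mn) at_ bt_.
  by have /andP[] := sub_b t (leq_trans lt_tm le_mn) at_ bt_.
(* The window length is one less than the next multiple of r + 1. *)
have le_union : count_below (predU a b) m <= count_below a m.
  by move/eqP: cut_a => cut_a; rewrite -ltnS -(ltn_pmul2l (ltn0Sn r)) -cut_a.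
move=> x lt_xn; case: (ltnP x m) => [lt_xm|le_mx]; last first.
  by apply: agree; rewrite le_mx.
transitivity (predU a b x).
  by apply: (count_below_sub _ le_union) => // y _ /= ->.
by apply/esym; apply: (@count_below_sub b (predU a b) m);
  rewrite -?eq_m' // => y _ /= ->; rewrite orbT.
Qed.

(** * Reserves and intervals *)

(** Positions of the queue range over [nat], hence this extension of membership
by false beyond [n]. *)
Definition nat_mem n (A : {set 'I_n}) : pred nat :=
  [pred i | i \in [seq val x | x in A]].

Lemma nat_memE n (A : {set 'I_n}) (x : 'I_n) : nat_mem A x = (x \in A).
Proof. by rewrite /nat_mem /= mem_image //; apply: val_inj. Qed.

Lemma count_nat_mem n (A : {set 'I_n}) : count_below (nat_mem A) n = #|A|.
Proof.
rewrite -(card_count_below (nat_mem A) (leqnn n)); congr #|pred_of_set _|.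
by apply/setP=> x; rewrite inE ltn_ord nat_memE.
Qed.

(** The top [B A] adds to [A] the idle positions of its window. *)
Lemma separated_tops l r n : (l + 1) * r + l <= n ->
  exists2 B : {set 'I_n} -> {set 'I_n},
    forall A : {set 'I_n}, #|A| = l -> A \subset B A /\ #|B A| = l + r
  & forall A A' : {set 'I_n}, #|A| = l -> #|A'| = l ->
      A \subset B A' -> A' \subset B A -> A = A'.
Proof.
move=> le_n.
have ex_ms (A : {set 'I_n}) : exists ms,
    #|A| = l -> steady_window r n (nat_mem A) ms.1 ms.2.
  have [cardA|ncardA] := eqVneq #|A| l; last first.
    (* An arbitrary value: only sets of size l are given a window. *)
    by exists (0, 0) => cardA; rewrite cardA eqxx in ncardA.
  have [|ms Pms] := @steady_window_exists r n (nat_mem A); last by exists ms.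
  by rewrite count_nat_mem cardA; nia.
have [ms Pms] := fin_all_exists ex_ms.
pose R A := [set x : 'I_n |
  (x < (ms A).1) && idle r (nat_mem A) (ms A).2 x].
exists (fun A => A :|: R A) => [A cardA | A A' cardA cardA' subA subA'].
  split; first exact: subsetUl.
  have [le_mn _ _ _] := Pms A cardA.
  have disjAR : A :&: R A = set0.
    apply/setP=> x; rewrite in_setI in_set in_set0 idleE nat_memE.
    by case: (x \in A); rewrite //= andbF.
  by rewrite cardsU disjAR cards0 subn0 cardA card_count_below //
             (count_idle (Pms A cardA)).
apply/setP=> x; rewrite -!nat_memE.
have idle_of (A1 A2 : {set 'I_n}) : A1 \subset A2 :|: R A2 -> forall y, y < n ->
    nat_mem A1 y -> ~~ nat_mem A2 y ->
    (y < (ms A2).1) && idle r (nat_mem A2) (ms A2).2 y.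
  move=> /subsetP sub12 y lt_yn; rewrite -[y]/(val (Ordinal lt_yn)) !nat_memE.
  by move=> /sub12; rewrite in_setU in_set => /orP[-> //|].
apply: (steady_window_separated (Pms A cardA) (Pms A' cardA')) => //.
- by rewrite !count_nat_mem cardA cardA'.
- exact: idle_of.
- exact: idle_of.
Qed.

(** Sending an interval to an element of size l that it contains is injective on
a disjoint family. *)
Lemma nu_le_bin l u n : nu n l u <= 'C(n, l).
Proof.
apply/bigmax_leqP => F /andP[/forall_inP maxF /trivIsetP trivF].
pose bottom (I : {set {set 'I_n}}) := odflt set0 [pick X in I | #|X| == l].
have bottomP I : I \in F -> (bottom I \in I) && (#|bottom I| == l).
  move=> /maxF /existsP[A /existsP[B /and4P[sAB cardA _ /eqP->]]].
  rewrite /bottom; case: pickP => //= /(_ A).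
  by rewrite cardA inE subxx sAB.
rewrite -[X in 'C(X, l)](card_ord n) -card_draws.
have inj_bottom : {in F &, injective bottom}.
  move=> I J FI FJ eq_bot; apply/eqP/negPn/negP => neIJ.
  have /andP[botI _] := bottomP I FI; have /andP[botJ _] := bottomP J FJ.
  by have /disjointFr/(_ botI) := trivF I J FI FJ neIJ; rewrite eq_bot botJ.
rewrite -(card_in_imset inj_bottom); apply/subset_leq_card/subsetP.
by move=> _ /imsetP[I FI ->]; rewrite inE; case/andP: (bottomP I FI).
Qed.

(** A set [X] common to [[A, B A]] and [[A', B A']] contains both [A] and [A'], and
lies below both tops. *)
Lemma bin_le_nu l u n (B : {set 'I_n} -> {set 'I_n}) :
    (forall A : {set 'I_n}, #|A| = l -> A \subset B A /\ #|B A| = u) ->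
    (forall A A' : {set 'I_n}, #|A| = l -> #|A'| = l ->
       A \subset B A' -> A' \subset B A -> A = A') ->
  'C(n, l) <= nu n l u.
Proof.
move=> topB sepB; pose D := [set A : {set 'I_n} | #|A| == l].
pose f A := interval A (B A).
have [trivF injF] : trivIset (f @: D) /\ {in D &, injective f}.
  apply: trivIimset => [A A'|].
    rewrite !inE => /eqP cardA /eqP cardA'; apply: contraR.
    case/pred0Pn=> X /=; rewrite !inE => /andP[/andP[sAX sXB] /andP[sA'X sXB']].
    by apply/eqP/sepB; rewrite ?(subset_trans sAX) ?(subset_trans sA'X).
  apply/imsetP=> -[A]; rewrite inE => /eqP /topB[sAB _] /setP/(_ A).
  by rewrite !inE subxx sAB.
rewrite -[X in 'C(X, l)](card_ord n) -card_draws -/D -(card_in_imset injF).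
apply: (bigmax_sup (f @: D)) => //.
rewrite /disjoint_maximal_intervals trivF andbT.
apply/forall_inP=> _ /imsetP[A DA ->]; move: DA; rewrite inE => cardA.
have [sAB cardB] := topB A (eqP cardA).
apply/existsP; exists A; apply/existsP; exists (B A).
by rewrite sAB cardA cardB !eqxx.
Qed.

Theorem theorem1p2 (l r n : nat) (hn : (l + 1) * r + l <= n) :
  nu n l (l + r) = 'C(n, l).
Proof.
have [B topB sepB] := separated_tops hn.
by apply/eqP; rewrite eqn_leq nu_le_bin (bin_le_nu topB sepB).
Qed.
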